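(* There is a universal constant $c>0$ such that the following holds. Let $n\ge1$, let $a_1,\dots,a_n>0$, let $V:\{0,\dots,n\}\to\mathbb{R}$, and suppose the ground state $\{\psi_k\}_{k=0}^n$ of $H=-A+V$ is log-concave. Then the spectral gap $\Delta$ of $H$ satisfies $$\Delta\ \ge\ \frac{c}{n\,S_n},\qquad S_n=\sum_{k=1}^n\frac1{a_k}.$$ Moreover, if $a_k=\sqrt{k(n+1-k)}$ for $1\le k\le n$ and $V$ is convex, then the spectral gap of $H=-A+V$ satisfies $\Delta\ge\frac14$.
   Context: $H=-A+V$ is the real symmetric $(n+1)\times(n+1)$ matrix indexed by $\{0,\dots,n\}$, where $V$ is the diagonal matrix with entries $V(0),\dots,V(n)$ and $A_{k-1,k}=A_{k,k-1}=a_k$ for $1\le k\le n$, all other entries of $A$ being $0$. Its lowest eigenvalue is simple and the normalized eigenvector (ground state) $(\psi_k)_{k=0}^n$ is chosen with positive entries. The spectral gap $\Delta$ is the difference between the second lowest and the lowest eigenvalue of $H$. A sequence $\{\psi_k\}_{k=0}^n$ is log-concave if $\psi_k^2\ge\psi_{k-1}\psi_{k+1}$ for $0<k<n$. Convexity of $V$ means $V(k+1)+V(k-1)-2V(k)\ge0$ for $0<k<n$. *)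

(* Defs.v *)
From mathcomp Require Import all_boot all_order all_algebra.
From mathcomp Require Import polyrcf.
From mathcomp Require Import reals.

Set Implicit Arguments.
Unset Strict Implicit.
Unset Printing Implicit Defensive.

Import Order.TTheory GRing.Theory Num.Theory.
Local Open Scope ring_scope.

(* The finite sequences a_1, ..., a_n, V(0), ..., V(n) and psi_0, ..., psi_n
   are functions on nat of which only these values are ever used. *)

(* rootsR lists the distinct real roots in increasing order; each eigenvalue
   is repeated according to its multiplicity. *)
Definition eigenvalues (R : realType) (m : nat) (M : 'M[R]_m) : seq R :=
  flatten [seq nseq (mup x (char_poly M)) x | x <- rootsR (char_poly M)].

Lemma mem_eigenvalues (R : realType) (m : nat) (M : 'M[R]_m) (x : R) :
  (x \in eigenvalues M) = eigenvalue M x.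
Proof.
have p0 : char_poly M != 0 by rewrite monic_neq0 ?char_poly_monic.
have := roots_on_rootsR p0 x; rewrite in_itv /= => rE.
rewrite eigenvalue_root_char rE.
apply/flattenP/idP => [[s /mapP[y yr ->]]|xr].
  by rewrite mem_nseq => /andP[_ /eqP->].
exists (nseq (mup x (char_poly M)) x); first by apply/mapP; exists x.
by rewrite mem_nseq eqxx andbT -XsubC_dvd // dvdp_XsubCl rE.
Qed.

Lemma eigenvalues_sorted (R : realType) (m : nat) (M : 'M[R]_m) :
  sorted <=%R (eigenvalues M).
Proof.
rewrite /eigenvalues; have : sorted <%R (rootsR (char_poly M)).
  exact: sorted_roots.
elim: (rootsR _) => //= y s IHs; rewrite (path_sortedE lt_trans).
case/andP => /allP ys {}/IHs IHs.
rewrite (sorted_pairwise le_trans) pairwise_cat -!(sorted_pairwise le_trans).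
rewrite IHs andbT; apply/andP; split; last first.
  by elim: (mup _ _) => //= k; case: k => //= k ->; rewrite lexx.
apply/allrelP => u v; rewrite mem_nseq => /andP[_ /eqP->].
case/flattenP => t /mapP[z zs ->]; rewrite mem_nseq => /andP[_ /eqP->].
exact/ltW/ys.
Qed.

Definition ground_energy (R : realType) (m : nat) (M : 'M[R]_m) : R :=
  (eigenvalues M)`_0.

Definition spectral_gap (R : realType) (m : nat) (M : 'M[R]_m) : R :=
  (eigenvalues M)`_1 - (eigenvalues M)`_0.

Definition hopping_mx (R : realType) (n : nat) (a : nat -> R) : 'M[R]_n.+1 :=
  \matrix_(i, j) if j == i.+1 :> nat then a j
                 else if i == j.+1 :> nat then a i else 0.

Definition hamiltonian (R : realType) (n : nat) (a V : nat -> R) :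
    'M[R]_n.+1 :=
  - hopping_mx n a + diag_mx (\row_(k < n.+1) V k).

Definition is_ground_state (R : realType) (n : nat) (M : 'M[R]_n.+1)
    (psi : nat -> R) : Prop :=
  [/\ M *m \col_(k < n.+1) psi k = ground_energy M *: \col_(k < n.+1) psi k,
      \sum_(k < n.+1) psi k ^+ 2 = 1
    & forall k : nat, (k <= n)%N -> 0 < psi k].

Definition log_concave (R : realType) (n : nat) (psi : nat -> R) : Prop :=
  forall k : nat, (0 < k < n)%N -> psi k.-1 * psi k.+1 <= psi k ^+ 2.

Definition convex_potential (R : realType) (n : nat) (V : nat -> R) : Prop :=
  forall k : nat, (0 < k < n)%N -> 0 <= V k.+1 + V k.-1 - 2 * V k.

(* Main.v *)
Require Import Defs.
From mathcomp Require Import all_boot all_order all_algebra.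
From mathcomp Require Import reals.
From mathcomp Require Import polyrcf complex.
From mathcomp Require Import ring lra zify.

(* Let psi > 0 be the ground state, v an eigenvector for the second lowest
   eigenvalue, f = v / psi and lambda the gap (it is positive, as a Jacobi
   matrix has simple spectrum).

   First bound (with c = 1): summing the two eigenvalue equations, the flux
   a_k psi_{k-1} psi_k (f_k - f_{k-1}) equals -lambda times the sum of
   psi_j^2 f_j over j < k, and also lambda times the sum over j >= k.  A
   log-concave psi decreases away from k on the side of the smaller of
   psi_{k-1}, psi_k, so on that side psi_j^2 <= psi_{k-1} psi_k, whence
   a_k |f_k - f_{k-1}| <= lambda n max|f|.  As f changes sign, its total
   variation is at least max|f|, so 1 <= lambda n S_n.

   Second bound (with 2 in place of 1/4): put b_k = a_{k+1} psi_{k+1} / psi_k,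
   d_k = a_k psi_{k-1} / psi_k and r_k = b_k / (n - k).  Since
   a_k^2 = k (n + 1 - k), we get d_k = k / r_{k-1}, so that
   V_k - E_0 = (n - k) r_k + k / r_{k-1}, a discrete Riccati equation, and
   convexity of V forces r to be nonincreasing.  Then
   b_k - b_{k+1} + d_{k+1} - d_k >= r_k + 1 / r_k >= 2, and evaluating the
   equation satisfied by f_{k+1} - f_k where its absolute value is largest
   gives lambda >= 2. *)

Set Implicit Arguments.
Unset Strict Implicit.
Unset Printing Implicit Defensive.

Import Order.TTheory GRing.Theory Num.Theory.
Local Open Scope ring_scope.
Local Open Scope sesquilinear_scope.

(** * Discrete convexity, the Riccati equation and a maximum principle *)

(** Increments of a convex sequence are nondecreasing: if [h] drops from [j] to [j.+1], it does not
    decrease going left from [j]; otherwise it does not decrease going right. *)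
Lemma convex_pos_side (R : realDomainType) (n : nat) (h : nat -> R) (j : nat) :
  (j <= n)%N ->
  (forall k, (0 < k < n)%N -> 0 <= h k.+1 + h k.-1 - 2 * h k) ->
  0 < h j ->
  (forall k, (j <= k <= n)%N -> 0 < h k) \/ (forall k, (k <= j)%N -> 0 < h k).
Proof.
move=> jn cvx hj.
case: (boolP ((j < n)%N && (h j.+1 < h j))) => [/andP[ltjn hlt]|hup].
- right => k kj.
  have step i : (i <= j)%N -> 0 < h (j - i)%N /\ h (j - i).+1 <= h (j - i)%N.
    elim: i => [|i IHi] ij; first by rewrite subn0; split=> //; exact: ltW.
    have [h1 h2] := IHi (ltnW ij).
    have e : (j - i)%N = (j - i.+1).+1 by lia.
    have := cvx (j - i)%N; rewrite e /= -e => c.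
    have {}c : 0 <= h (j - i).+1 + h (j - i.+1)%N - 2 * h (j - i)%N by apply: c; lia.
    by split; lra.
  by have := step (j - k)%N; rewrite leq_subr subKn // => /(_ isT)[].
- left => k /andP[jk kn].
  have step i : (j + i <= n)%N ->
     0 < h (j + i)%N /\ ((j + i < n)%N -> h (j + i)%N <= h (j + i).+1).
    elim: i => [|i IHi] ij.
      rewrite addn0; split=> // ltjn; rewrite leNgt; apply/negP => lt.
      by rewrite ltjn lt in hup.
    have [|h1 /(_ _)h2] := IHi; first by lia.
    have {}h2 : h (j + i)%N <= h (j + i).+1 by apply: h2; lia.
    rewrite addnS; split; first exact: lt_le_trans h2.
    by move=> ltn; have /= := cvx (j + i).+1 ltn; lra.
  by have [] := step (k - j)%N; rewrite subnKC.
Qed.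

(* At k = 0 and k = n the out-of-range values r 0.-1 and r n have
   coefficient 0. *)
Lemma riccati_nonincreasing (R : realType) (n : nat) (U r : nat -> R) :
  (forall k, (k < n)%N -> 0 < r k) ->
  (forall k, (k <= n)%N -> U k = (n%:R - k%:R) * r k + k%:R / r k.-1) ->
  convex_potential n U ->
  forall k, (k.+1 < n)%N -> r k.+1 <= r k.
Proof.
move=> rpos Ueq Ucvx j ltjn; rewrite leNgt; apply/negP => lt_r.
set s := r j in lt_r.
(* The linear function k |-> n s + k (1/s - s) is the potential whose solution
   is the constant s; h compares U to it. *)
have s0 : 0 < s by apply: rpos; lia.
pose h k := U k - (n%:R * s + k%:R * (s^-1 - s)).
have hE k : (k <= n)%N ->
    h k = (n%:R - k%:R) * (r k - s) + k%:R * ((r k.-1)^-1 - s^-1).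
  by move=> kn; rewrite /h Ueq //; ring.
have hcvx k : (0 < k < n)%N -> 0 <= h k.+1 + h k.-1 - 2 * h k.
  move=> kn; have := Ucvx k kn; rewrite /h; case: k kn => // k _ /=.
  rewrite -[k.+2%:R]natr1 -[k.+1%:R]natr1; lra.
have npos k : (k < n)%N -> 0 < n%:R - k%:R :> R by rewrite subr_gt0 ltr_nat.
have hj : 0 < h j.+1.
  by rewrite hE ?(ltnW ltjn) //= subrr mulr0 addr0 mulr_gt0 ?npos ?subr_gt0.
have [hp|hp] := convex_pos_side (ltnW ltjn) hcvx hj.
(* Going right, [r k.-1 > s] makes the second term of [hE] nonpositive, so [h k > 0] forces
   [r k > s]. At [k = n] only that second term is left, against [h n > 0]. *)
- have up i : (j.+1 + i < n)%N -> s < r (j.+1 + i)%N.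
    elim: i => [|i IHi] lti; first by rewrite addn0.
    have {}IHi : s < r (j.+1 + i)%N by apply: IHi; lia.
    have := hp (j.+1 + i.+1)%N; rewrite hE; last by lia.
    rewrite addnS /= => hpos.
    have {}hpos : 0 < (n%:R - (j.+1 + i).+1%:R) * (r (j.+1 + i).+1 - s) +
       (j.+1 + i).+1%:R * ((r (j.+1 + i)%N)^-1 - s^-1) by apply: hpos; lia.
    have neg : (j.+1 + i).+1%:R * ((r (j.+1 + i)%N)^-1 - s^-1) <= 0.
      by rewrite pmulr_rle0 ?ltr0n // subr_le0 lef_pV2 ?posrE ?(ltW IHi) ?(lt_trans s0 IHi).
    have : 0 < (n%:R - (j.+1 + i).+1%:R) * (r (j.+1 + i).+1 - s) by lra.
    by rewrite pmulr_rgt0 ?subr_gt0 ?ltr_nat // -addnS.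
  have hn : 0 < h n by apply: hp; lia.
  have sr : s < r n.-1.
    have -> : n.-1 = (j.+1 + (n.-1 - j.+1))%N by lia.
    by apply: up; lia.
  move: hn; rewrite hE // subrr mul0r add0r pmulr_rgt0; last by rewrite ltr0n; lia.
  by rewrite subr_gt0 ltf_pV2 ?posrE ?(lt_trans s0 sr) // ltNge (ltW sr).
(* Going left, [r k <= s] and [h k > 0] give [r k.-1 < s], starting from [r j = s]. Hence
   [r 0 <= s], while [h 0 = n (r 0 - s)] is positive. *)
- have dn i : (i < j)%N -> r (j - i.+1)%N < s.
    elim: i => [|i IHi] lti.
      have := hp j (leqnSn j); rewrite hE; last by lia.
      rewrite subrr mulr0 add0r subn1 pmulr_rgt0; last by rewrite ltr0n.
      by rewrite subr_gt0 ltf_pV2 ?posrE ?rpos //; lia.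
    have {}IHi : r (j - i.+1)%N < s by apply: IHi; lia.
    have := hp (j - i.+1)%N; rewrite hE; last by lia.
    rewrite (_ : (j - i.+1).-1 = (j - i.+2)%N); last by lia.
    move=> hpos.
    have {}hpos : 0 < (n%:R - (j - i.+1)%:R) * (r (j - i.+1)%N - s) +
       (j - i.+1)%:R * ((r (j - i.+2)%N)^-1 - s^-1) by apply: hpos; lia.
    have neg : (n%:R - (j - i.+1)%:R) * (r (j - i.+1)%N - s) <= 0.
      by rewrite pmulr_rle0 ?subr_le0 ?(ltW IHi) // npos //; lia.
    have : 0 < (j - i.+1)%:R * ((r (j - i.+2)%N)^-1 - s^-1) by lra.
    rewrite pmulr_rgt0; last by rewrite ltr0n; lia.
    by rewrite subr_gt0 ltf_pV2 ?posrE ?rpos //; lia.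
  have := hp 0%N isT; rewrite hE // mul0r addr0 subr0 pmulr_rgt0; last first.
    by rewrite ltr0n; lia.
  rewrite subr_gt0; case: (posnP j) => [j0|j0]; first by rewrite /s j0 ltxx.
  have := dn j.-1; rewrite (_ : (j - j.-1.+1)%N = 0%N); last by lia.
  by move=> /(_ _)lt0 lt1; have := lt_trans (lt0 ltac:(lia)) lt1; rewrite ltxx.
Qed.

(** For [u k = f k.+1 - f k], differencing the equation gives [lambda u k = b k.+1 (u k - u k.+1) +
    d k (u k - u k.-1) + (b k - b k.+1 + d k.+1 - d k) u k]. Where [|u|] is largest, the first two
    terms do not oppose the sign of [u k], so [lambda] is at least the last coefficient. *)
Lemma curvature_le_gap (R : realFieldType) (n : nat) (b d f : nat -> R)
    (lambda kappa : R) :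
  (forall k, (k <= n)%N -> 0 <= b k) -> (forall k, (k <= n)%N -> 0 <= d k) ->
  b n = 0 -> d 0 = 0 ->
  (forall k, (k <= n)%N ->
    lambda * f k = b k * (f k - f k.+1) + d k * (f k - f k.-1)) ->
  (forall k, (k < n)%N -> kappa <= b k - b k.+1 + (d k.+1 - d k)) ->
  (exists2 k, (k < n)%N & f k.+1 != f k) ->
  kappa <= lambda.
Proof.
move=> b0 d0 bn dz feq curv [k0 k0n fk0].
pose u k := f k.+1 - f k.
have [[k /= kn] _ kmax] := @arg_maxP _ R 'I_n (Ordinal k0n) xpredT (fun k => `|u k|) isT.
have {}kmax i : (i < n)%N -> `|u i| <= `|u k|.
  by move=> lti; apply: (kmax (Ordinal lti)).
have upos : 0 < `|u k|.
  by apply: lt_le_trans (kmax k0 k0n); rewrite normr_gt0 subr_eq0.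
have eq_u : (lambda - b k - d k.+1) * u k = - (b k.+1 * u k.+1) - d k * u k.-1.
  have e1 := feq k.+1 kn; have e0 := feq k (ltnW kn).
  case: (posnP k) e0 e1 => [->|k_gt0]; rewrite /u /=.
    by rewrite dz !mul0r; lra.
  by rewrite (prednK k_gt0); lra.
(* For [k.+1 = n], maximality of [|u k|] does not reach [u n]; there [b n = 0]. *)
have bound : `|b k.+1 * u k.+1| <= b k.+1 * `|u k|.
  rewrite normrM ger0_norm ?b0 //; have [/kmax|] := ltnP k.+1 n.
    by apply: ler_wpM2l; rewrite b0.
  by move=> nk; have -> : k.+1 = n; [apply/eqP; rewrite eqn_leq kn|rewrite bn !mul0r].
have boundd : `|d k * u k.-1| <= d k * `|u k|.
  rewrite normrM ger0_norm ?d0 ?(ltnW kn) //.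
  case: (posnP k) => [->|k_gt0]; first by rewrite dz !mul0r.
  by apply: ler_wpM2l; rewrite ?d0 ?kmax ?(ltnW kn) //; lia.
have upper : (b k + d k.+1 - lambda) * `|u k| <= (b k.+1 + d k) * `|u k|.
  apply: le_trans (ler_wpM2r (normr_ge0 _) (ler_norm _)) _.
  rewrite -normrM -normrN -mulNr !opprD !opprK.
  have -> : - b k - d k.+1 + lambda = lambda - b k - d k.+1 by ring.
  rewrite eq_u; apply: le_trans (ler_normB _ _) _.
  by rewrite normrN mulrDl lerD.
by have := curv k kn; move: upper; rewrite ler_pM2r //; lra.
Qed.

(* The eigenvalue equation of -A + V; it is used with a 0 = a n.+1 = 0, which
   removes the out-of-range terms at k = 0 and k = n. *)
Definition jacobi_eq (R : pzRingType) (n : nat) (a V : nat -> R) (E : R)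
    (v : nat -> R) : Prop :=
  forall k, (k <= n)%N -> V k * v k - a k.+1 * v k.+1 - a k * v k.-1 = E * v k.

(** * The ground state transform and the gap for convex potentials *)

(** Subtracting [v k / psi k] times the equation of [psi] from that of [v] cancels [V] (Doob
    transform): what is left is a birth-death equation for the quotient. *)
Lemma ground_state_quotient (R : realFieldType) (n : nat) (a V psi v : nat -> R)
    (E0 E1 : R) :
  a 0 = 0 -> a n.+1 = 0 ->
  (forall k, (k <= n)%N -> 0 < psi k) ->
  jacobi_eq n a V E0 psi -> jacobi_eq n a V E1 v ->
  forall k, (k <= n)%N ->
    (E1 - E0) * (v k / psi k) =
      a k.+1 * psi k.+1 / psi k * (v k / psi k - v k.+1 / psi k.+1) +
      a k * psi k.-1 / psi k * (v k / psi k - v k.-1 / psi k.-1).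
Proof.
move=> az an psi0 eqpsi eqv k kn.
have nz j : (j <= n)%N -> psi j != 0 by move=> jn; rewrite gt_eqF ?psi0.
have nzk := nz k kn.
(* The case [k = n] is separate because [psi n.+1] may be 0; there [a n.+1 = 0]. *)
have -> : a k.+1 * psi k.+1 / psi k * (v k / psi k - v k.+1 / psi k.+1) =
    (a k.+1 * psi k.+1 * v k / psi k - a k.+1 * v k.+1) / psi k.
  move: kn; rewrite leq_eqVlt => /orP[/eqP ->|/nz nz1]; last by field; rewrite nzk nz1.
  by rewrite an !mul0r subrr mul0r.
have -> : a k * psi k.-1 / psi k * (v k / psi k - v k.-1 / psi k.-1) =
    (a k * psi k.-1 * v k / psi k - a k * v k.-1) / psi k.
  case: (posnP k) => [->|k_gt0]; first by rewrite az !mul0r subrr mul0r.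
  by have nz1 := nz k.-1 (leq_trans (leq_pred k) kn); field; rewrite nzk nz1.
have e0 := eqpsi k kn; have e1 := eqv k kn.
have -> : (E1 - E0) * (v k / psi k) = (E1 * v k - (E0 * psi k) * v k / psi k) / psi k.
  by field.
by rewrite -e0 -e1; field.
Qed.

(** A constant quotient would make the right-hand side of [ground_state_quotient] vanish, and then
    [v] too, as [E1 - E0] is nonzero. *)
Lemma jacobi_eq_not_proportional (R : realFieldType) (n : nat)
    (a V psi v : nat -> R) (E0 E1 : R) :
  a 0 = 0 -> a n.+1 = 0 ->
  (forall k, (k <= n)%N -> 0 < psi k) ->
  jacobi_eq n a V E0 psi -> jacobi_eq n a V E1 v ->
  E0 != E1 -> (exists2 k, (k <= n)%N & v k != 0) ->
  exists2 k, (k < n)%N & v k.+1 / psi k.+1 != v k / psi k.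
Proof.
move=> az an psi0 eqpsi eqv neqE [j jn vj].
pose f k := v k / psi k.
have [/existsP[k fk]|/existsPn cst] := boolP [exists k : 'I_n, f k.+1 != f k].
  by exists k.
have {}cst k : (k < n)%N -> f k.+1 = f k.
  by move=> kn; apply/eqP; have := cst (Ordinal kn); rewrite negbK.
have := ground_state_quotient az an psi0 eqpsi eqv jn; rewrite -!/(f _) => e.
have e1 : a j.+1 * psi j.+1 / psi j * (f j - f j.+1) = 0.
  move: (jn); rewrite leq_eqVlt => /orP[/eqP ->|/cst ->]; last by rewrite subrr mulr0.
  by rewrite an !mul0r.
have e2 : a j * psi j.-1 / psi j * (f j - f j.-1) = 0.
  case: j {vj e e1} jn => [|j] jn; first by rewrite az !mul0r.
  by rewrite cst ?subrr ?mulr0.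
move: e; rewrite e1 e2 addr0 => /eqP; rewrite mulf_eq0 subr_eq0 eq_sym (negPf neqE).
by rewrite mulf_eq0 invr_eq0 (negPf vj) gt_eqF ?psi0.
Qed.

(** With these [a], the matrix [A] is the adjacency matrix of the n-cube acting on functions of the
    Hamming weight, in an orthonormal basis. For [V = 0] every [r k] is 1 and the bound 2 is
    attained. *)
Lemma hypercube_gap (R : realType) (n : nat) (a V psi v : nat -> R) (E0 E1 : R) :
  a 0 = 0 -> a n.+1 = 0 ->
  (forall k, (1 <= k <= n)%N -> 0 < a k) ->
  (forall k, (1 <= k <= n)%N -> a k ^+ 2 = k%:R * (n.+1%:R - k%:R)) ->
  convex_potential n V ->
  (forall k, (k <= n)%N -> 0 < psi k) ->
  jacobi_eq n a V E0 psi -> jacobi_eq n a V E1 v ->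
  E0 != E1 -> (exists2 k, (k <= n)%N & v k != 0) ->
  2 <= E1 - E0.
Proof.
move=> az an a0 aE Vcvx psi0 eqpsi eqv neqE vn0.
have nz j : (j <= n)%N -> psi j != 0 by move=> jn; rewrite gt_eqF ?psi0.
pose b k := a k.+1 * psi k.+1 / psi k.
pose d k := a k * psi k.-1 / psi k.
pose r k := b k / (n%:R - k%:R).
have npos k : (k < n)%N -> 0 < n%:R - k%:R :> R by rewrite subr_gt0 ltr_nat.
have bE k : (k <= n)%N -> b k = (n%:R - k%:R) * r k.
  rewrite leq_eqVlt => /orP[/eqP->|kn]; last by rewrite mulrC divfK // gt_eqF ?npos.
  by rewrite subrr mul0r /b an !mul0r.
have rpos k : (k < n)%N -> 0 < r k.
  move=> kn; apply: divr_gt0; last exact: npos.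
  by rewrite /b divr_gt0 ?mulr_gt0 ?psi0 ?a0 // ltnW.
(* Here [d k.+1 * b k = a k.+1 ^+ 2 = k.+1 * (n - k)]. *)
have dE k : (k <= n)%N -> d k = k%:R / r k.-1.
  case: k => [|k] kn; first by rewrite /d az !mul0r.
  have ak : a k.+1 != 0 by rewrite gt_eqF ?a0.
  have nk : n%:R - k%:R != 0 :> R by rewrite gt_eqF ?npos.
  have -> : k.+1%:R = a k.+1 ^+ 2 / (n%:R - k%:R) :> R.
    by rewrite aE // -natrB ?subSS ?natrB ?mulfK // ltnW.
  by rewrite /d /r /b /=; field; rewrite nk ak !nz // ltnW.
have rdec := @riccati_nonincreasing R n (fun k => V k - E0) r rpos.
have {}rdec : forall k, (k.+1 < n)%N -> r k.+1 <= r k.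
  apply: rdec => k kn; last by have := Vcvx k kn; lra.
  (* The Riccati equation is the eigenvalue equation of [psi] divided by [psi k]. *)
  rewrite -bE // -dE // /b /d -mulrDl; apply: canRL (mulfK (nz k kn)) _.
  by rewrite mulrBl -eqpsi //; ring.
have f_eq := ground_state_quotient az an psi0 eqpsi eqv.
have f_ncst := jacobi_eq_not_proportional az an psi0 eqpsi eqv neqE vn0.
apply: (@curvature_le_gap _ n b d (fun k => v k / psi k)) => //.
- move=> k kn; rewrite bE // mulr_ge0 ?subr_ge0 ?ler_nat //.
  move: kn; rewrite leq_eqVlt => /orP[/eqP->|/rpos/ltW//].
  (* At [k = n] the divisor [n - k] is 0, so [r n = 0] by the convention on division by 0. *)
  by rewrite /r subrr invr0 mulr0.
- move=> [|k] kn; rewrite dE // ?mul0r // divr_ge0 ?ler0n //.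
  exact/ltW/rpos.
- by rewrite /b an !mul0r.
- by rewrite /d az !mul0r.
(* Wherever their coefficients are nonzero, [r k.+1 <= r k <= r k.-1], so replacing both neighbours
   by [r k] only lowers the expression, down to [r k + 1 / r k]. *)
move=> k kn; rewrite !bE ?(ltnW kn) // !dE ?(ltnW kn) //=.
have rk := rpos k kn.
have h1 : (n%:R - k.+1%:R) * r k.+1 <= (n%:R - k.+1%:R) * r k.
  move: (kn); rewrite leq_eqVlt => /orP[/eqP<-|lt]; first by rewrite subrr !mul0r.
  by rewrite ler_pM2l ?npos // rdec.
have h2 : k%:R / r k.-1 <= k%:R / r k.
  case: k kn rk {h1} => [|k] kn rk; first by rewrite !mul0r.
  by rewrite ler_pM2l ?ltr0n // lef_pV2 ?posrE ?rpos ?rdec // ltnW.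
have h3 : 2 <= r k + (r k)^-1.
  rewrite -subr_ge0; have -> : r k + (r k)^-1 - 2 = (r k - 1) ^+ 2 / r k.
    by field; rewrite gt_eqF.
  by rewrite divr_ge0 ?sqr_ge0 ?ltW.
by move: h1 h2 h3; rewrite -natr1; lra.
Qed.

(** * The gap for log-concave ground states *)

(** The right-hand side is a discrete Wronskian: [V] cancels from its increments, and it starts at 0
    because [a 0 = 0]. If also [a n.+1 = 0] and [E0 != E1], the case [k = n.+1] is the orthogonality
    of [v] and [psi]. *)
Lemma jacobi_partial_sum (R : comPzRingType) (n : nat) (a V psi v : nat -> R)
    (E0 E1 : R) :
  a 0 = 0 -> jacobi_eq n a V E0 psi -> jacobi_eq n a V E1 v ->
  forall k, (k <= n.+1)%N ->
    (E1 - E0) * (\sum_(0 <= j < k) v j * psi j) =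
      - (a k * (v k * psi k.-1 - v k.-1 * psi k)).
Proof.
move=> az eqpsi eqv; elim=> [|k IHk] kn.
  by rewrite big_geq // az mul0r mulr0 oppr0.
rewrite big_nat_recr //=.
rewrite mulrDr.
rewrite IHk; last exact: ltnW.
have -> : (E1 - E0) * (v k * psi k) = E1 * v k * psi k - E0 * psi k * v k by ring.
by rewrite -eqpsi // -eqv //; ring.
Qed.

(** Log-concavity makes the ratios [psi j.+1 / psi j] nonincreasing, so once one is at most 1, all
    later ones are. [log_concave_head] is the mirror image. *)
Lemma log_concave_tail (R : realType) (n : nat) (psi : nat -> R) (k : nat) :
  (forall j, (j <= n)%N -> 0 < psi j) -> log_concave n psi ->
  psi k.+1 <= psi k ->
  forall j, (k < j <= n)%N -> psi j <= psi k.+1.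
Proof.
move=> psi0 lc le_k j /andP[kj jn].
have step i : (k.+1 + i <= n)%N ->
    psi (k + i).+1 <= psi (k + i)%N /\ psi (k + i).+1 <= psi k.+1.
  elim: i => [|i IHi] lti; first by rewrite addn0.
  have [|h1 h2] := IHi; first by lia.
  have p1 : 0 < psi (k + i).+1 by apply: psi0; lia.
  have p0 : 0 < psi (k + i)%N by apply: psi0; lia.
  rewrite addnS; have lt2 : (0 < (k + i).+1 < n)%N by lia.
  have hl : psi (k + i).+2 <= psi (k + i).+1.
    have /= := lc _ lt2; rewrite mulrC expr2 => c.
    by rewrite -(ler_pM2r p0); apply: le_trans c _; rewrite ler_pM2l.
  by split=> //; exact: le_trans h2.
have [] := step (j - k.+1)%N; first by lia.
by rewrite -addSn subnKC.
Qed.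

Lemma log_concave_head (R : realType) (n : nat) (psi : nat -> R) (k : nat) :
  (forall j, (j <= n)%N -> 0 < psi j) -> log_concave n psi ->
  (k < n)%N -> psi k <= psi k.+1 ->
  forall j, (j <= k)%N -> psi j <= psi k.
Proof.
move=> psi0 lc kn le_k j jk.
have step i : (i <= k)%N ->
    psi (k - i)%N <= psi (k - i).+1 /\ psi (k - i)%N <= psi k.
  elim: i => [|i IHi] lti; first by rewrite subn0.
  have [|h1 h2] := IHi; first by lia.
  have e : (k - i)%N = (k - i.+1).+1 by lia.
  have lt2 : (0 < k - i < n)%N by lia.
  have p1 : 0 < psi (k - i)%N by apply: psi0; lia.
  have p0 : 0 < psi (k - i).+1 by apply: psi0; lia.
  have hl : psi (k - i.+1)%N <= psi (k - i)%N.
    have := lc _ lt2; rewrite {1}e /= expr2 => c.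
    by rewrite -(ler_pM2r p0); apply: le_trans c _; rewrite ler_pM2l.
  by rewrite -e; split=> //; exact: le_trans h2.
have [] := step (k - j)%N; first by lia.
by rewrite subKn.
Qed.

Lemma log_concave_flux (R : realType) (n : nat) (a V psi v : nat -> R)
    (E0 E1 F : R) :
  a 0 = 0 -> a n.+1 = 0 -> E0 < E1 ->
  (forall j, (j <= n)%N -> 0 < psi j) -> log_concave n psi ->
  jacobi_eq n a V E0 psi -> jacobi_eq n a V E1 v ->
  (forall j, (j <= n)%N -> `|v j / psi j| <= F) ->
  forall k, (k < n)%N ->
    a k.+1 * `|v k.+1 / psi k.+1 - v k / psi k| <= (E1 - E0) * n%:R * F.
Proof.
move=> az an ltE psi0 lc eqpsi eqv Fmax k kn.
have lam0 : 0 < E1 - E0 by rewrite subr_gt0.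
have psum := jacobi_partial_sum az eqpsi eqv.
have F0 : 0 <= F by apply: le_trans (normr_ge0 _) (Fmax 0 isT).
have pk := psi0 k (ltnW kn); have pk1 := psi0 k.+1 kn.
have term c j : (j <= n)%N -> psi j <= c -> `|v j * psi j| <= F * c ^+ 2.
  move=> jn jc; have pj := psi0 j jn.
  have -> : v j * psi j = v j / psi j * psi j ^+ 2 by field; rewrite gt_eqF.
  rewrite normrM ler_pM ?Fmax // normrX lerXn2r ?nnegrE //; last first.
    by rewrite gtr0_norm.
  exact: le_trans (ltW pj) jc.
have flux : a k.+1 * (v k.+1 / psi k.+1 - v k / psi k) * (psi k * psi k.+1) =
    a k.+1 * (v k.+1 * psi k - v k * psi k.+1).
  by field; rewrite !gt_eqF.
(* The side of [k] on which [psi] decreases has at most [n] indices, each contributing at most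
   [F * (psi k * psi k.+1)]. *)
suff bound : `|\sum_(0 <= j < k.+1) v j * psi j| <= n%:R * F * (psi k * psi k.+1).
  have [ak|ak] := leP (a k.+1) 0.
    apply: (@le_trans _ _ 0); first by rewrite mulr_le0_ge0.
    by rewrite !mulr_ge0 // ltW.
  rewrite -(gtr0_norm ak) -normrM -(ler_pM2r (mulr_gt0 pk pk1)).
  rewrite -[X in _ * X <= _](gtr0_norm (mulr_gt0 pk pk1)) -normrM flux.
  have := psum k.+1 (ltnW kn); rewrite /= => /(congr1 Num.norm); rewrite normrN => <-.
  rewrite normrM gtr0_norm //.
  have -> : (E1 - E0) * n%:R * F * (psi k * psi k.+1) =
    (E1 - E0) * (n%:R * F * (psi k * psi k.+1)) by ring.
  by rewrite ler_pM2l.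
have [le_k|le_k] := leP (psi k) (psi k.+1).
  apply: le_trans (ler_norm_sum _ _ _) _.
  apply: (@le_trans _ _ (\sum_(0 <= j < k.+1) F * psi k ^+ 2)).
    rewrite big_nat_cond [leRHS]big_nat_cond; apply: ler_sum => j /andP[/andP[_ jk] _].
    apply: term; first by lia.
    exact: (log_concave_head psi0 lc kn le_k).
  rewrite sumr_const_nat subn0 -[leLHS]mulr_natl -[leRHS]mulrA ler_pM ?ler_nat ?ler0n //.
    by rewrite mulr_ge0 ?sqr_ge0.
  by rewrite ler_wpM2l // expr2 ler_pM2l.
(* By orthogonality the sum over [j <= k] is minus the sum over [j > k], the side on which [psi] now
   decreases. *)
have total : \sum_(0 <= j < n.+1) v j * psi j = 0.
  have := psum n.+1 (leqnn _); rewrite an mul0r oppr0 => /eqP.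
  by rewrite mulf_eq0 gt_eqF //= => /eqP.
rewrite (@big_cat_nat _ _ _ k.+1) //= in total; last by lia.
move/eqP: total; rewrite addr_eq0 => /eqP->; rewrite normrN.
apply: le_trans (ler_norm_sum _ _ _) _.
apply: (@le_trans _ _ (\sum_(k.+1 <= j < n.+1) F * psi k.+1 ^+ 2)).
  rewrite big_nat_cond [leRHS]big_nat_cond; apply: ler_sum => j /andP[/andP[jk jn] _].
  apply: term; first by lia.
  by apply: (log_concave_tail psi0 lc (ltW le_k)); lia.
rewrite sumr_const_nat -[leLHS]mulr_natl -[leRHS]mulrA ler_pM ?ler_nat ?ler0n //.
- by rewrite mulr_ge0 ?sqr_ge0.
- by lia.
by rewrite ler_wpM2l // expr2 ler_pM2r // ltW.
Qed.

Lemma dist_le_total_variation (R : realDomainType) (n : nat) (f : nat -> R)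
    (i j : nat) :
  (i <= n)%N -> (j <= n)%N ->
  `|f i - f j| <= \sum_(0 <= k < n) `|f k.+1 - f k|.
Proof.
wlog ji : i j / (j <= i)%N.
  move=> W iN jN; have [ji|/ltnW ij] := leqP j i; first exact: W.
  by rewrite distrC; exact: W.
move=> iN jN; rewrite -telescope_sumr //.
apply: le_trans (ler_norm_sum _ _ _) _.
rewrite (@big_cat_nat _ _ _ j 0 n) //= (@big_cat_nat _ _ _ i j n) //=.
by rewrite addrCA lerDl addr_ge0 // sumr_ge0.
Qed.

Lemma log_concave_gap (R : realType) (n : nat) (a V psi v : nat -> R)
    (E0 E1 : R) :
  (1 <= n)%N -> a 0 = 0 -> a n.+1 = 0 ->
  (forall k, (1 <= k <= n)%N -> 0 < a k) ->
  (forall j, (j <= n)%N -> 0 < psi j) -> log_concave n psi ->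
  jacobi_eq n a V E0 psi -> jacobi_eq n a V E1 v ->
  E0 < E1 -> (exists2 k, (k <= n)%N & v k != 0) ->
  (n%:R * \sum_(1 <= k < n.+1) (a k)^-1)^-1 <= E1 - E0.
Proof.
move=> n1 az an a0 psi0 lc eqpsi eqv ltE [k0 k0n vk0].
pose f k := v k / psi k.
have lam0 : 0 < E1 - E0 by rewrite subr_gt0.
have [[i /= iN] _ imax] :=
  @arg_maxP _ R 'I_n.+1 (Ordinal (k0n : (k0 < n.+1)%N)) xpredT (fun k => `|f k|) isT.
have {}imax j : (j <= n)%N -> `|f j| <= `|f i|.
  by move=> jn; apply: (imax (Ordinal (jn : (j < n.+1)%N))).
have F0 : 0 < `|f i|.
  apply: lt_le_trans (imax k0 k0n).
  by rewrite normr_gt0 /f mulf_neq0 // invr_neq0 // gt_eqF ?psi0.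
(* If [f i * f j] were positive for all [j], then [f i] times the vanishing sum of [v j * psi j]
   would have only positive terms. *)
have [j jn fj] : exists2 j, (j <= n)%N & f i * f j <= 0.
  have [/existsP[j fj]|/existsPn pos] := boolP [exists j : 'I_n.+1, f i * f j <= 0].
    by exists j => //; rewrite -ltnS.
  have := jacobi_partial_sum az eqpsi eqv (leqnn n.+1).
  rewrite an mul0r oppr0 => /eqP; rewrite mulf_eq0 gt_eqF //= => /eqP tot.
  have /eqP := congr1 ( *%R (f i)) tot.
  rewrite mulr0 big_mkord mulr_sumr psumr_eq0 => [/allP|j _].
    move=> /(_ (Ordinal iN) (mem_index_enum _)) /=; rewrite gt_eqF //.
    have -> : f i * (v i * psi i) = `|f i| ^+ 2 * psi i ^+ 2.
      by rewrite real_normK ?num_real // /f; field; rewrite gt_eqF ?psi0.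
    by rewrite mulr_gt0 ?exprn_gt0 ?psi0.
  have pj : 0 < psi j by rewrite psi0 // -ltnS.
  have -> : f i * (v j * psi j) = f i * f j * psi j ^+ 2.
    by rewrite /f; field; rewrite (gt_eqF pj) gt_eqF ?psi0.
  by rewrite mulr_ge0 ?sqr_ge0 // ltW // ltNge.
have osc : `|f i| <= `|f i - f j|.
  rewrite -(@ler_pXn2r _ 2) ?nnegrE ?normr_ge0 // !real_normK ?num_real //.
  have -> : (f i - f j) ^+ 2 = f i ^+ 2 - 2 * (f i * f j) + f j ^+ 2 by ring.
  by have := sqr_ge0 (f j); lra.
have flux := log_concave_flux az an ltE psi0 lc eqpsi eqv imax.
set S := \sum_(1 <= k < n.+1) _.
have tv : \sum_(0 <= k < n) `|f k.+1 - f k| <= (E1 - E0) * n%:R * `|f i| * S.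
  rewrite /S big_add1 /= mulr_sumr big_nat_cond [leRHS]big_nat_cond.
  apply: ler_sum => k /andP[/andP[_ kn] _].
  by rewrite ler_pdivlMr ?a0 // mulrC; exact: flux.
have S0 : 0 < S.
  rewrite /S big_ltn // ltr_wpDr ?invr_gt0 ?a0 ?n1 // big_nat_cond sumr_ge0 //.
  by move=> k /andP[/andP[k1 kn] _]; rewrite invr_ge0 ltW ?a0 //; lia.
have nS0 : 0 < n%:R * S by rewrite mulr_gt0 ?ltr0n.
rewrite -[X in X <= _]mul1r ler_pdivrMr // -(ler_pM2r F0) mul1r.
apply: le_trans osc _.
apply: le_trans (@dist_le_total_variation _ n f i j iN jn) _.
by apply: le_trans tv _; rewrite -!mulrA [`|f i| * S]mulrC.
Qed.

(** * Spectral theory of real symmetric matrices *)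

Lemma char_poly_conj (F : fieldType) (n : nat) (P D : 'M[F]_n) :
  P \in unitmx -> char_poly (invmx P *m D *m P) = char_poly D.
Proof.
move=> Pu; rewrite /char_poly.
have -> : char_poly_mx (invmx P *m D *m P) =
    map_mx polyC (invmx P) *m char_poly_mx D *m map_mx polyC P.
  rewrite /char_poly_mx mulmxBr mulmxBl !map_mxM /=; congr (_ - _).
  by rewrite scalar_mxC -mulmxA -map_mxM mulVmx // map_mx1 mulmx1.
rewrite !det_mulmx mulrAC -det_mulmx -map_mxM mulVmx //.
by rewrite map_mx1 det1 mul1r.
Qed.

(** Over [R[i]] the matrix is Hermitian, hence unitarily diagonalizable with real diagonal. Only
    that diagonal [d] comes back to [R]; [P] stays complex. *)
Lemma symmetric_spectral (R : rcfType) (n : nat) (M : 'M[R]_n) :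
  M^T = M ->
  exists (P : 'M[R[i]]_n) (d : 'rV[R]_n), P \is unitarymx /\
    map_mx (real_complex R) M =
      invmx P *m diag_mx (map_mx (real_complex R) d) *m P.
Proof.
move=> Msym; set Mc := map_mx _ M.
have Mherm : Mc \is hermsymmx.
  apply: realsym_hermsym.
    apply/is_hermitianmxP; rewrite expr0 scale1r map_mx_id //.
    by rewrite /Mc -[in LHS]Msym map_trmx.
  by apply/mxOverP => i j; rewrite mxE complex_real.
exists (spectralmx Mc), (map_mx (@complex.Re R) (spectral_diag Mc)).
split; first exact: spectral_unitarymx.
have -> : map_mx (real_complex R) (map_mx (@complex.Re R) (spectral_diag Mc)) =
    spectral_diag Mc.
  apply/rowP => j; rewrite !mxE; apply: RRe_real.
  by have /mxOverP := hermitian_spectral_diag_real Mherm; apply.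
exact/orthomx_spectralP/hermitian_normalmx.
Qed.

Lemma spectral_char_poly (R : rcfType) (n : nat) (M : 'M[R]_n)
    (P : 'M[R[i]]_n) (d : 'rV[R]_n) :
  P \is unitarymx ->
  map_mx (real_complex R) M =
    invmx P *m diag_mx (map_mx (real_complex R) d) *m P ->
  char_poly M = \prod_(x <- [seq d 0 i | i : 'I_n]) ('X - x%:P).
Proof.
move=> Pu eqM; apply: (map_poly_inj (real_complex R)).
rewrite map_char_poly eqM char_poly_conj ?unitarymx_unit //.
rewrite char_poly_trig ?diag_mx_is_trig // map_prod_XsubC big_image /=.
by apply: eq_bigr => i _; rewrite !mxE eqxx.
Qed.

Lemma count_flatten_nseq (T : eqType) (m : T -> nat) (r : seq T) (x : T) :
  uniq r -> count_mem x (flatten [seq nseq (m y) y | y <- r]) =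
    if x \in r then m x else 0%N.
Proof.
elim: r => //= y r IHr /andP[yr /IHr {}IHr].
rewrite count_cat IHr count_nseq /= in_cons [x == y]eq_sym.
case: eqVneq => [<-|_] /=; last by rewrite mul0n.
by rewrite (negPf yr) mul1n addn0.
Qed.

(** Both lists contain each [x] as often as its multiplicity as a root of the characteristic
    polynomial. *)
Lemma eigenvalues_perm (R : realType) (n : nat) (M : 'M[R]_n) (s : seq R) :
  char_poly M = \prod_(x <- s) ('X - x%:P) -> perm_eq (eigenvalues M) s.
Proof.
move=> cM; have p0 : char_poly M != 0 by rewrite monic_neq0 ?char_poly_monic.
apply/allP => x _ /=; rewrite count_flatten_nseq ?uniq_roots //.
rewrite -mu_prod_XsubC -cM.
have := roots_on_rootsR p0 x; rewrite in_itv /= => <-.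
by case: ifPn => // /mupNroot ->.
Qed.

Lemma ground_energy_le (R : realType) (n : nat) (M : 'M[R]_n) (x : R) :
  x \in eigenvalues M -> ground_energy M <= x.
Proof.
rewrite /ground_energy; have := eigenvalues_sorted M.
case: (eigenvalues M) => //= y s.
rewrite (path_sortedE le_trans) => /andP[/allP ys _].
by rewrite in_cons => /orP[/eqP->|/ys].
Qed.

(** In coordinates [y] for an eigenbasis, [x M x^T - E x x^T] is the sum of the nonnegative terms
    [(d i - E) |y i|^2]. If it is at most 0, each term vanishes and [y] is supported where
    [d i = E]. *)
Lemma rayleigh_minimizer (R : realType) (n : nat) (M : 'M[R]_n) (x : 'rV[R]_n) :
  M^T = M ->
  (x *m M *m x^T) 0 0 <= ground_energy M * (x *m x^T) 0 0 ->
  x *m M = ground_energy M *: x.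
Proof.
move=> Msym; set E := ground_energy M => le_E.
have [P [d [Pu eqM]]] := symmetric_spectral Msym.
have dE i : E <= d 0 i.
  apply: ground_energy_le.
  rewrite (perm_mem (eigenvalues_perm (spectral_char_poly Pu eqM))).
  by apply/mapP; exists i; rewrite ?mem_enum.
set c := real_complex R; pose xc := map_mx c x.
have Pun := unitarymx_unit Pu.
pose y := xc *m invmx P.
have xcE : xc = y *m P by rewrite mulmxKV.
(* As [x] is real, its transpose is its conjugate transpose. *)
have xcT : map_mx c x^T = P^t* *m y^t*.
  rewrite -map_mxM -trmx_mul -xcE.
  apply/matrixP => i j; rewrite !mxE.
  by apply/esym/CrealP; rewrite complex_real.
have PP : P *m P^t* = 1%:M by apply/unitarymxP.
have qM : c ((x *m M *m x^T) 0 0) = \sum_i c (d 0 i) * `|y 0 i| ^+ 2.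
  have -> : c ((x *m M *m x^T) 0 0) = (xc *m map_mx c M *m map_mx c x^T) 0 0.
    by rewrite -!map_mxM [RHS]mxE.
  rewrite xcT eqM !mulmxA -/y -[_ *m P *m P^t*]mulmxA PP mulmx1 mxE.
  apply: eq_bigr => j _; rewrite mul_mx_diag !mxE mulrAC -normCK mulrC.
  by rewrite mulrC.
have q1 : c ((x *m x^T) 0 0) = \sum_i `|y 0 i| ^+ 2.
  have -> : c ((x *m x^T) 0 0) = (xc *m map_mx c x^T) 0 0.
    by rewrite -!map_mxM [RHS]mxE.
  rewrite xcT xcE !mulmxA -[_ *m P *m P^t*]mulmxA PP mulmx1 mxE.
  by apply: eq_bigr => j _; rewrite !mxE -normCK.
have term_ge0 i : 0 <= (c (d 0 i) - c E) * `|y 0 i| ^+ 2.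
  by rewrite mulr_ge0 ?exprn_ge0 // subr_ge0 lecR.
have sum_le0 : \sum_i (c (d 0 i) - c E) * `|y 0 i| ^+ 2 <= 0.
  under eq_bigr do rewrite mulrBl.
  by rewrite sumrB -qM -mulr_sumr -q1 -rmorphM subr_le0 lecR.
have yD : y *m diag_mx (map_mx c d) = c E *: y.
  apply/rowP => i; rewrite mul_mx_diag mxE [X in _ * X]mxE [RHS]mxE.
  have /eqP : (c (d 0 i) - c E) * `|y 0 i| ^+ 2 = 0.
    have : \sum_i (c (d 0 i) - c E) * `|y 0 i| ^+ 2 == 0.
      by rewrite eq_le sum_le0 sumr_ge0.
    rewrite psumr_eq0 // => /allP /(_ i (mem_index_enum _)) /=.
    by move=> /eqP.
  rewrite mulf_eq0 sqrf_eq0 normr_eq0 subr_eq0 => /orP[/eqP->|/eqP->].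
    by rewrite mulrC.
  by rewrite mul0r mulr0.
apply: (@map_mx_inj _ _ c 1 n).
by rewrite map_mxM map_mxZ -/xc eqM !mulmxA yD -scalemxAl -xcE.
Qed.

Lemma eigenvalues_size (R : realType) (n : nat) (M : 'M[R]_n) :
  M^T = M -> size (eigenvalues M) = n.
Proof.
move=> Msym; have [P [d [Pu eqM]]] := symmetric_spectral Msym.
rewrite (perm_size (eigenvalues_perm (spectral_char_poly Pu eqM))).
by rewrite size_map size_enum_ord.
Qed.

(** Replacing a lowest eigenvector by its entrywise absolute value preserves the norm and, the
    off-diagonal entries being nonpositive, does not increase the quadratic form; so it is again a
    minimizer. *)
Lemma ground_state_nonneg (R : realType) (n : nat) (M : 'M[R]_n) :
  (0 < n)%N -> M^T = M -> (forall i j, i != j -> M i j <= 0) ->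
  exists w : 'rV[R]_n, [/\ w *m M = ground_energy M *: w,
    forall i, 0 <= w 0 i & w != 0].
Proof.
move=> n0 Msym offdiag; set E := ground_energy M.
have /eigenvalueP[v eqv v0] : eigenvalue M E.
  by rewrite -mem_eigenvalues mem_nth // eigenvalues_size.
exists (map_mx Num.norm v); split.
- apply: rayleigh_minimizer => //.
  have -> : (map_mx Num.norm v *m (map_mx Num.norm v)^T) 0 0 = (v *m v^T) 0 0.
    rewrite !mxE; apply: eq_bigr => j _; rewrite !mxE -normrM ger0_norm //.
    by rewrite -expr2 sqr_ge0.
  have -> : E * (v *m v^T) 0 0 = (v *m M *m v^T) 0 0.
    by rewrite eqv -scalemxAl [RHS]mxE.
  rewrite !mxE; apply: ler_sum => j _; rewrite !mxE !mulr_suml.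
  apply: ler_sum => i _; rewrite !mxE.
  have [->|neq] := eqVneq i j.
    rewrite [leLHS]mulrAC [leRHS]mulrAC -normrM ger0_norm //.
    by rewrite -expr2 sqr_ge0.
  rewrite [leLHS]mulrAC [leRHS]mulrAC -normrM.
  by apply: ler_wnM2r; [exact: offdiag | exact: ler_norm].
- by move=> i; rewrite mxE.
apply: contraNneq v0 => w0; apply/eqP/rowP => i.
by have /rowP/(_ i) := w0; rewrite !mxE => /normr0P/eqP.
Qed.

(** * The Hamiltonian as a Jacobi matrix: positivity and simple spectrum *)

(** For [k = 0] the last condition reads [i = 0], since [0.-1 = 0]; the value [a 0 = 0] makes that
    term harmless. *)
Lemma hamiltonian_entry (R : realType) (n : nat) (a V : nat -> R) (i k : 'I_n.+1) :
  a 0 = 0 ->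
  hamiltonian n a V i k =
    (if i == k :> nat then V k else 0) - (if i == k.+1 :> nat then a k.+1 else 0) -
    (if i == k.-1 :> nat then a k else 0).
Proof.
move=> az; rewrite !mxE -val_eqE /=.
case: i k => [i ilt] [k klt] /=; rewrite {ilt klt}.
have [->|ik] := eqVneq i k.
  rewrite (_ : k == k.+1 = false); last by lia.
  rewrite subr0 oppr0 add0r; case: k => [|k] /=; first by rewrite az subr0.
  by rewrite (_ : k.+1 == k = false) ?subr0 //; lia.
rewrite mulr0n addr0; case: k ik => [|k] /= ik.
  by rewrite (negPf ik) subr0 sub0r; case: eqP => [->|].
rewrite eqSS [k == i]eq_sym; have [->|_] := eqVneq i k.
  by rewrite (_ : k == k.+2 = false) ?subr0 ?sub0r //; lia.
by rewrite sub0r subr0; case: eqP => [->|].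
Qed.

Lemma hamiltonian_sym (R : realType) (n : nat) (a V : nat -> R) :
  (hamiltonian n a V)^T = hamiltonian n a V.
Proof.
apply/matrixP => i j; rewrite !mxE; congr (- _ + _).
  by have [->|] := eqVneq (i : nat) j.+1; [rewrite (_ : j == j.+2 :> nat = false) //; lia|].
by have [->|] := eqVneq i j; rewrite ?eqxx // eq_sym => /negPf ->.
Qed.

(** The morphism [f] covers both real eigenvectors (identity) and complex ones (inclusion of [R] in
    [R[i]]). *)
Lemma hamiltonian_row_mul (R : realType) (F : comNzRingType)
    (f : {rmorphism R -> F}) (n : nat) (a V : nat -> R) (u : nat -> F)
    (k : 'I_n.+1) :
  a 0 = 0 -> a n.+1 = 0 ->
  ((\row_(i < n.+1) u i) *m map_mx f (hamiltonian n a V)) 0 k =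
    f (V k) * u k - f (a k.+1) * u k.+1 - f (a k) * u k.-1.
Proof.
move=> az an; rewrite mxE.
have pick (m : nat) (c : R) :
    \sum_(i < n.+1) u i * f (if i == m :> nat then c else 0) =
    if (m < n.+1)%N then f c * u m else 0.
  rewrite -(big_ord1_eq +%R (fun j => f c * u j)) [RHS]big_mkcond /=.
  by apply: eq_bigr => i _; case: eqP => _; rewrite ?rmorph0 ?mulr0 // mulrC.
transitivity (\sum_(i < n.+1) (u i * f (if i == k :> nat then V k else 0) -
    u i * f (if i == k.+1 :> nat then a k.+1 else 0) -
    u i * f (if i == k.-1 :> nat then a k else 0))).
  by apply: eq_bigr => i _; rewrite !mxE -!mulrBr -!rmorphB -hamiltonian_entry ?mxE.
rewrite !sumrB !pick ltn_ord (leq_ltn_trans (leq_pred k)) //.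
congr (_ - _ - _); case: ltnP => // nk.
by rewrite (_ : k.+1 = n.+1) ?an ?rmorph0 ?mul0r //; apply/eqP; rewrite eqn_leq ltn_ord.
Qed.

Lemma eigenvector_jacobi_eq (R : realType) (F : comNzRingType)
    (f : {rmorphism R -> F}) (n : nat) (a V : nat -> R) (E : F) (u : nat -> F) :
  a 0 = 0 -> a n.+1 = 0 ->
  (\row_(i < n.+1) u i) *m map_mx f (hamiltonian n a V) =
    E *: (\row_(i < n.+1) u i) ->
  jacobi_eq n (f \o a) (f \o V) E u.
Proof.
move=> az an /rowP eqv k kn; have := eqv (Ordinal (kn : (k < n.+1)%N)).
by rewrite hamiltonian_row_mul // !mxE.
Qed.

(** As [a k.+1] is nonzero for [k < n], the equation at [k] determines [u k.+1] from [u k] and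
    [u k.-1]. *)
Lemma jacobi_eq_zero (F : idomainType) (n : nat) (a V : nat -> F) (E : F)
    (u : nat -> F) :
  a 0 = 0 -> (forall k, (1 <= k <= n)%N -> a k != 0) ->
  jacobi_eq n a V E u -> u 0 = 0 -> forall k, (k <= n)%N -> u k = 0.
Proof.
move=> az a0 equ u0.
have step k : ((k < n)%N -> u k.+1 = 0) /\ ((k <= n)%N -> u k = 0).
  elim: k => [|k [IH1 IH0]].
    split=> // n0; have := equ 0 isT.
    rewrite /= u0 az !mulr0 subr0 sub0r => /eqP.
    by rewrite oppr_eq0 mulf_eq0 (negPf (a0 1 _)) ?n0 //= => /eqP.
  split=> // kn; have := equ k.+1 (ltnW kn).
  rewrite /= IH1 ?IH0 1?ltnW // 1?ltnW // !mulr0 subr0 sub0r => /eqP.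
  by rewrite oppr_eq0 mulf_eq0 (negPf (a0 k.+2 _)) //= => /eqP.
by move=> k; have [] := step k.
Qed.

(** At a zero of [u] with [k > 0], the equation leaves [a k.+1 * u k.+1 + a k * u k.-1 = 0] with
    both terms nonnegative, so [u k.-1 = 0]. Descending to [u 0 = 0], the recurrence kills all of
    [u]. *)
Lemma jacobi_eq_pos (R : realDomainType) (n : nat) (a V : nat -> R) (E : R)
    (u : nat -> R) :
  a 0 = 0 -> a n.+1 = 0 -> (forall k, (1 <= k <= n)%N -> 0 < a k) ->
  jacobi_eq n a V E u -> (forall k, (k <= n)%N -> 0 <= u k) ->
  (exists2 k, (k <= n)%N & u k != 0) ->
  forall k, (k <= n)%N -> 0 < u k.
Proof.
move=> az an a0 equ u_ge0 [k0 k0n uk0].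
have down k : (k <= n)%N -> u k = 0 -> u 0 = 0.
  elim: k => // k IHk kn uk; apply: IHk; first exact: ltnW.
  have := equ k.+1 kn; rewrite uk !mulr0 sub0r /= => eq0.
  have ak : 0 < a k.+1 by apply: a0.
  have h1 : 0 <= a k.+1 * u k by rewrite mulr_ge0 ?(ltW ak) ?u_ge0 // ltnW.
  have h2 : 0 <= a k.+2 * u k.+2.
    have [le2|gt2] := ltnP k.+1 n; first by rewrite mulr_ge0 ?u_ge0 // ltW ?a0.
    by rewrite (_ : k.+2 = n.+1) ?an ?mul0r //; apply/eqP; rewrite eqn_leq !ltnS kn gt2.
  have /eqP : a k.+1 * u k = 0 by lra.
  by rewrite mulf_eq0 gt_eqF //= => /eqP.
move=> k kn; rewrite lt_neqAle u_ge0 // andbT eq_sym; apply/eqP => uk.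
move: uk0; rewrite (jacobi_eq_zero az _ equ (down k kn uk)) ?eqxx //.
by move=> j jn; rewrite gt_eqF ?a0.
Qed.

(** An eigenvector is determined by its entry of index 0, so eigenspaces are lines, whereas
    [d 0 i = d 0 j] with [i != j] would give two independent eigenvectors. *)
Lemma hamiltonian_eigenvalues_uniq (R : realType) (n : nat) (a V : nat -> R) :
  a 0 = 0 -> a n.+1 = 0 -> (forall k, (1 <= k <= n)%N -> 0 < a k) ->
  uniq (eigenvalues (hamiltonian n a V)).
Proof.
move=> az an a0; set M := hamiltonian n a V.
have [P [d [Pu eqM]]] := symmetric_spectral (hamiltonian_sym n a V).
rewrite (perm_uniq (eigenvalues_perm (spectral_char_poly Pu eqM))).
rewrite map_inj_uniq ?enum_uniq // => i j dij; apply/eqP/negPn/negP => ij.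
set c := real_complex R in eqM.
have Pun := unitarymx_unit Pu.
(* A left eigenvector y P for the eigenvalue d i vanishes if its entry of
   index 0 does. *)
have zero (y : 'rV[R[i]]_n.+1) : y *m diag_mx (map_mx c d) = c (d 0 i) *: y ->
    (y *m P) 0 ord0 = 0 -> y = 0.
  move=> yD yP0; pose u k := (y *m P) 0 (inord k).
  have rowE : \row_(k < n.+1) u k = y *m P.
    by apply/rowP => k; rewrite mxE /u inord_val.
  have equ : jacobi_eq n (c \o a) (c \o V) (c (d 0 i)) u.
    apply: eigenvector_jacobi_eq => //; rewrite rowE -/M eqM !mulmxA.
    by rewrite mulmxK // yD -scalemxAl.
  have u0 : u 0 = 0 by rewrite /u -[RHS]yP0; congr (_ _ _); apply/val_inj; rewrite /= inordK.
  have yP : y *m P = 0.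
    have cz : (c \o a) 0 = 0 by rewrite /= az; exact: (rmorph0 (real_complex R)).
    have ca0 k : (1 <= k <= n)%N -> (c \o a) k != 0.
      by move=> kn; rewrite /= (fmorph_eq0 (real_complex R)) gt_eqF ?a0.
    rewrite -rowE; apply/rowP => k; rewrite mxE [RHS]mxE.
    by apply: (jacobi_eq_zero cz ca0 equ u0); rewrite -ltnS.
  by rewrite -[y](mulmxK Pun) yP mul0mx.
have deltaD (k : 'I_n.+1) : d 0 k = d 0 i ->
    delta_mx 0 k *m diag_mx (map_mx c d) = c (d 0 i) *: (delta_mx 0 k : 'rV_n.+1).
  move=> dk; apply/rowP => l; rewrite mul_mx_diag !mxE /= mulrC.
  by have [->|_] := eqVneq l k; rewrite ?dk // !mulr0.
(* These coefficients cancel the entry of index 0 of [y *m P]. Then [y = 0] yields [P j ord0 = 0],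
   so [zero] applies to [delta_mx 0 j] itself, which is absurd. *)
pose y : 'rV[R[i]]_n.+1 := P j ord0 *: delta_mx 0 i - P i ord0 *: delta_mx 0 j.
have y0 : y = 0.
  apply: zero.
    by rewrite /y mulmxBl -!scalemxAl !deltaD // scalerBr !scalerA mulrC [P i _ * _]mulrC.
  rewrite /y mulmxBl -!scalemxAl -!rowE !mxE.
  by rewrite mulrC subrr.
have Pj0 : P j ord0 = 0.
  have /rowP/(_ i) := y0; rewrite !mxE !eqxx (negPf ij) /=.
  by rewrite mulr1 mulr0 subr0.
have : delta_mx 0 j = 0 :> 'rV[R[i]]_n.+1.
  by apply: zero; [exact: deltaD | rewrite -rowE mxE].
by move=> /rowP/(_ j)/eqP; rewrite !mxE !eqxx /= oner_eq0.
Qed.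

Lemma hamiltonian_eigenvector (R : realType) (n : nat) (a V : nat -> R) (E : R) :
  a 0 = 0 -> a n.+1 = 0 ->
  E \in eigenvalues (hamiltonian n a V) ->
  exists2 v : nat -> R, jacobi_eq n a V E v & exists2 k, (k <= n)%N & v k != 0.
Proof.
move=> az an; rewrite mem_eigenvalues => /eigenvalueP[w eqw w0].
exists (fun k => w 0 (inord k)).
  apply: (@eigenvector_jacobi_eq _ _ idfun) => //; rewrite map_mx_id //.
  rewrite (_ : \row_i _ = w) //.
  by apply/rowP => k; rewrite mxE inord_val.
have /rV0Pn[k wk] := w0.
by exists k; [rewrite -ltnS|rewrite inord_val].
Qed.

(** Supplies the ground state for the second bound, which is given none: the nonnegative minimizer
    is positive by [jacobi_eq_pos]. *)
Lemma hamiltonian_ground_state (R : realType) (n : nat) (a V : nat -> R) :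
  a 0 = 0 -> a n.+1 = 0 -> (forall k, (1 <= k <= n)%N -> 0 < a k) ->
  exists2 psi : nat -> R,
    jacobi_eq n a V (ground_energy (hamiltonian n a V)) psi &
    forall k, (k <= n)%N -> 0 < psi k.
Proof.
move=> az an a0; set M := hamiltonian n a V.
have [|w [eqw w_ge0 w0]] := @ground_state_nonneg _ _ M (ltn0Sn n) (hamiltonian_sym _ _ _).
  move=> i k ik; rewrite hamiltonian_entry // -val_eqE /= in ik *.
  rewrite (negPf ik) sub0r -opprD oppr_le0 addr_ge0 //; case: eqP => // e.
    by have := ltn_ord i; rewrite e ltnS => kn; rewrite ltW // a0.
  case: (posnP k) => [->|k0]; first by rewrite az.
  by rewrite ltW // a0 // k0 -ltnS ltn_ord.
have equ : jacobi_eq n a V (ground_energy M) (fun k => w 0 (inord k)).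
  apply: (@eigenvector_jacobi_eq _ _ idfun) => //; rewrite map_mx_id //.
  rewrite (_ : \row_i _ = w) //.
  by apply/rowP => k; rewrite mxE inord_val.
exists (fun k => w 0 (inord k)) => //.
apply: (jacobi_eq_pos az an a0 equ) => //.
have /rV0Pn[k wk] := w0.
by exists k; [rewrite -ltnS|rewrite inord_val].
Qed.

(** The truncated sequence vanishes at 0 and [n.+1], the boundary values that the lemmas on
    [jacobi_eq] assume. *)
Lemma hamiltonian_restrict (R : realType) (n : nat) (a V : nat -> R) :
  hamiltonian n a V =
  hamiltonian n (fun k => if (1 <= k <= n)%N then a k else 0) V.
Proof.
congr (- _ + _); apply/matrixP => i j; rewrite !mxE.
have [e|_] := eqVneq (j : nat) i.+1.
  by rewrite -[(j <= n)%N]ltnS ltn_ord e.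
by have [e|//] := eqVneq (i : nat) j.+1; rewrite -[(i <= n)%N]ltnS ltn_ord e.
Qed.

Lemma hamiltonian_second_eigenvalue (R : realType) (n : nat) (a V : nat -> R) :
  (1 <= n)%N ->
  a 0 = 0 -> a n.+1 = 0 -> (forall k, (1 <= k <= n)%N -> 0 < a k) ->
  exists E1 : R,
    [/\ spectral_gap (hamiltonian n a V) = E1 - ground_energy (hamiltonian n a V),
        ground_energy (hamiltonian n a V) < E1
      & exists2 v : nat -> R, jacobi_eq n a V E1 v &
          exists2 k, (k <= n)%N & v k != 0].
Proof.
move=> n1 az an a0; set M := hamiltonian n a V.
have sz : size (eigenvalues M) = n.+1 by apply/eigenvalues_size/hamiltonian_sym.
have mem1 : (eigenvalues M)`_1 \in eigenvalues M by rewrite mem_nth ?sz.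
exists (eigenvalues M)`_1; split=> //.
  rewrite lt_neqAle ground_energy_le // andbT /ground_energy.
  by rewrite nth_uniq ?sz // hamiltonian_eigenvalues_uniq.
exact: hamiltonian_eigenvector.
Qed.

Theorem mainTheorem3 (R : realType) :
  (exists c : R, 0 < c /\
    forall (n : nat) (a V psi : nat -> R),
      (1 <= n)%N ->
      (forall k : nat, (1 <= k <= n)%N -> 0 < a k) ->
      is_ground_state (hamiltonian n a V) psi ->
      log_concave n psi ->
      c / (n%:R * \sum_(1 <= k < n.+1) (a k)^-1)
        <= spectral_gap (hamiltonian n a V)) /\
  (forall (n : nat) (a V : nat -> R),
      (1 <= n)%N ->
      (forall k : nat, (1 <= k <= n)%N ->
        a k = Num.sqrt (k%:R * (n.+1 - k)%:R)) ->
      convex_potential n V ->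
      4^-1 <= spectral_gap (hamiltonian n a V)).
Proof.
split.
- exists 1; split=> // n a V psi n1 a0 gs lc.
  rewrite hamiltonian_restrict in gs *.
  set a' := fun k => _ in gs *.
  have az : a' 0 = 0 by [].
  have an : a' n.+1 = 0 by rewrite /a' ltnn.
  have a'E k : (1 <= k <= n)%N -> a' k = a k by rewrite /a' => ->.
  have a'0 k : (1 <= k <= n)%N -> 0 < a' k by move=> kn; rewrite a'E ?a0.
  case: gs => gs_eq _ psi0.
  have eqpsi : jacobi_eq n a' V (ground_energy (hamiltonian n a' V)) psi.
    apply: (@eigenvector_jacobi_eq _ _ idfun) => //; rewrite map_mx_id //.
    (* The ground state is a column eigenvector; by symmetry its transpose is a left eigenvector, as
       [eigenvector_jacobi_eq] expects. *)
    have := congr1 trmx gs_eq; rewrite trmx_mul hamiltonian_sym linearZ /=.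
    by rewrite (_ : (\col_k psi k)^T = \row_k psi k) //; apply/rowP => k; rewrite !mxE.
  have [E1 [-> ltE [v eqv v0]]] := hamiltonian_second_eigenvalue V n1 az an a'0.
  rewrite (eq_big_nat _ _ (F2 := fun k => (a' k)^-1)) => [|k kn]; last first.
    by rewrite a'E.
  rewrite mul1r; exact: log_concave_gap eqpsi eqv ltE v0.
move=> n a V n1 aE cvx; rewrite hamiltonian_restrict.
set a' := fun k => _.
have az : a' 0 = 0 by [].
have an : a' n.+1 = 0 by rewrite /a' ltnn.
have a'E k : (1 <= k <= n)%N -> a' k = Num.sqrt (k%:R * (n.+1 - k)%:R).
  by rewrite /a' => kn; rewrite kn aE.
have a'0 k : (1 <= k <= n)%N -> 0 < a' k.
  move=> kn; rewrite a'E // sqrtr_gt0 mulr_gt0 ?ltr0n ?subn_gt0 //; lia.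
have a'2 k : (1 <= k <= n)%N -> a' k ^+ 2 = k%:R * (n.+1%:R - k%:R).
  move=> kn; rewrite a'E // sqr_sqrtr ?mulr_ge0 ?ler0n // natrB //; lia.
have [psi eqpsi psi0] := hamiltonian_ground_state V az an a'0.
have [E1 [-> ltE [v eqv v0]]] := hamiltonian_second_eigenvalue V n1 az an a'0.
have := hypercube_gap az an a'0 a'2 cvx psi0 eqpsi eqv (negbT (lt_eqF ltE)) v0.
lra.
Qed.
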